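(* Let $G\subset \mathrm{SL}_3(\mathbb{C})$ be a finite abelian subgroup and let $D'\subset G\text{-Hilb}\,\mathbb{A}^3$ be a possibly reducible but connected exceptional divisor. Then every $\theta\in\mathfrak{C}_0$ satisfies the inequality $$\sum_{\chi\,\in\,\bigcup_{C\subset D'}G\text{-ig}(C)}\theta(\chi)>0,$$ where $C$ ranges over the exceptional curves contained in $D'$.
   Context: $G$ acts diagonally on $\mathbb{A}^3$ with coordinates $x,y,z$. $G\text{-Hilb}\,\mathbb{A}^3$ is the moduli space of $G$-clusters ($G$-invariant zero-dimensional subschemes $Z\subset\mathbb{A}^3$ with $H^0(\mathcal{O}_Z)\cong\mathbb{C}[G]$); it is a toric crepant resolution of $\mathbb{A}^3/G$, given by a triangulation of the junior simplex (the triangle with vertices the standard basis vectors $e_1,e_2,e_3$) into smooth triangles with vertices in $N$, the lattice generated by $\mathbb{Z}^3$ and the vectors $\frac1r(a_1,a_2,a_3)$ for $\mathrm{diag}(\varepsilon^{a_1},\varepsilon^{a_2},\varepsilon^{a_3})\in G$, $\varepsilon=e^{2\pi i/r}$. Exceptional curves are the torus-invariant compact curves, i.e. edges not in the boundary of the junior simplex; irreducible exceptional divisors are the compact ones, corresponding to interior vertices; a (possibly reducible) exceptional divisor is a reduced union of these. Torus-fixed points correspond to triangles $\tau$. For a triangle $\tau$ with monomial $G$-cluster $Z_\tau$ and $\rho\in\mathrm{Irr}(G)$, $r_{\rho,\tau}$ is the unique monomial of character $\rho$ not in the ideal of $Z_\tau$. If $C$ corresponds to the common edge of triangles $\tau,\tau'$,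 the total $G$-igsaw piece is $G\text{-ig}(C)=\{\rho: r_{\rho,\tau}\neq r_{\rho,\tau'}\}$. $\Theta=\{\theta\in\mathrm{Hom}_{\mathbb{Z}}(\mathbb{Z}^{\mathrm{Irr}(G)},\mathbb{Q}):\sum_\rho\theta(\rho)=0\}$; $\theta$ is extended additively to $\mathrm{Rep}(G)$. A $G$-constellation is a $G$-equivariant coherent sheaf $F$ on $\mathbb{A}^3$ with $H^0(F)\cong\mathbb{C}[G]$ (equivalently a representation of the McKay quiver with relations of dimension vector $(1,\dots,1)$). It is $\theta$-stable if $\theta(H^0(E))>0$ for all proper nonzero equivariant subsheaves $E$; $\theta$ is generic if semistability implies stability. $\Theta$ has a wall-and-chamber structure such that the moduli space of $\theta$-stable $G$-constellations is constant on chambers; $\mathfrak{C}_0$ is the (open) chamber containing all $\theta$ with $\theta(\rho)>0$ for every nontrivial $\rho$, whose moduli space is $G\text{-Hilb}\,\mathbb{A}^3$. *)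

(* Defs.v *)
From Stdlib Require Import Relation_Operators.
From mathcomp Require Import all_boot all_order all_algebra all_fingroup.
From mathcomp Require Import all_character.
From mathcomp Require Import boolp reals complex.

Set Implicit Arguments.
Unset Strict Implicit.
Unset Printing Implicit Defensive.

Import Order.TTheory GRing.Theory Num.Theory.

Local Open Scope ring_scope.
Local Open Scope complex_scope.

(* A finite subgroup of SL_3(C) acting diagonally on A^3 is a finite group G   *)
(* with a faithful representation rG by diagonal matrices of determinant 1;    *)
(* x_i is the i-th coordinate of A^3 (i : 'I_3) and transforms under g with    *)
(* the weight rG g i i.                                                        *)

Section Definitions.

Variables (R : realType) (gT : finGroupType) (G : {group gT}).
Variable rG : mx_representation R[i] G 3.

Definition diagonal_SL3 : Prop :=
  [/\ mx_faithful rG, {in G, forall g, is_diag_mx (rG g)}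
    & {in G, forall g, \det (rG g) = 1}].

Definition Irr : irrType R[i] G := DecSocleType (regular_repr R[i] G).

Definition irr_char (rho : Irr) (g : gT) : R[i] := \tr (irr_repr rho g).

(* m : monomial stands for x_0 ^ m 0 * x_1 ^ m 1 * x_2 ^ m 2 *)
Definition monomial := {ffun 'I_3 -> nat}.

Definition has_character (m : monomial) (rho : Irr) : bool :=
  [forall g in G, \prod_i rG g i i ^+ m i == irr_char rho g].

(* The monomials outside a monomial ideal form a basis of the quotient ring,   *)
(* so the quotient is C[G] exactly when each character occurs once among them. *)
Record monomial_cluster := MonomialCluster {
  cluster_ideal : pred monomial;
  cluster_ideal_closed : forall m m' : monomial,
    (forall i, (m i <= m' i)%N) -> cluster_ideal m -> cluster_ideal m';
  cluster_basis : forall rho : Irr,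
    exists m, ~~ cluster_ideal m && has_character m rho;
  cluster_basis_unique : forall (rho : Irr) (m m' : monomial),
    ~~ cluster_ideal m && has_character m rho ->
    ~~ cluster_ideal m' && has_character m' rho -> m = m'
}.

(* r_{rho, tau} *)
Definition repr_monomial (rho : Irr) (tau : monomial_cluster) : monomial :=
  xchoose (cluster_basis tau rho).

Definition point := 'rV[rat]_3.

Definition weight (u : point) (m : monomial) : rat :=
  \sum_i u 0 i * (m i)%:R.

Definition in_junior_simplex (u : point) : Prop :=
  (forall i, 0 <= u 0 i) /\ \sum_i u 0 i = 1.

(* The torus-invariant chart of G-Hilb A^3 at the fixed point Z_tau has        *)
(* coordinate ring generated by the Laurent monomials m / r_{rho, tau}, for m  *)
(* of character rho.  The cone of this chart is therefore cut out by the       *)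
(* inequalities below, and [cell tau] is its slice by the junior simplex.      *)
(* Equivalently, u is interior to the cone when the free orbit of (1, 1, 1),   *)
(* moved by the one-parameter subgroup u, degenerates to Z_tau.                *)
Definition cell (tau : monomial_cluster) (u : point) : Prop :=
  in_junior_simplex u /\
  forall (rho : Irr) (m : monomial), has_character m rho ->
    weight u (repr_monomial rho tau) <= weight u m.

(* tau spans a maximal cone: some point of its cell lies on no wall *)
Definition is_triangle (tau : monomial_cluster) : Prop :=
  exists2 u, in_junior_simplex u &
  forall (rho : Irr) (m : monomial), has_character m rho ->
    m != repr_monomial rho tau ->
    weight u (repr_monomial rho tau) < weight u m.

Definition vertex_of (tau : monomial_cluster) (v : point) : Prop :=
  cell tau v /\
  forall a b : point, cell tau a -> cell tau b ->
    v = 2%:R^-1 *: (a + b) -> a = b.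

(* An interior vertex v is identified with the compact divisor D_v. *)
Definition interior_vertex (v : point) : Prop :=
  (exists2 tau, is_triangle tau & vertex_of tau v) /\ forall i, 0 < v 0 i.

(* The segment from v to w is the common edge of the distinct triangles tau    *)
(* and tau'.  Edges lying in the boundary of the junior simplex belong to a    *)
(* single triangle, so these are exactly the exceptional curves.               *)
Definition exceptional_curve (tau tau' : monomial_cluster) (v w : point)
    : Prop :=
  [/\ is_triangle tau, is_triangle tau',
      ~ (cluster_ideal tau =1 cluster_ideal tau'), v <> w
    & [/\ vertex_of tau v, vertex_of tau w, vertex_of tau' v
        & vertex_of tau' w]].

Definition Gig (tau tau' : monomial_cluster) : {set Irr} :=
  [set rho | repr_monomial rho tau != repr_monomial rho tau'].

(* D lists the interior vertices v whose divisors D_v are the components of    *)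
(* D'.                                                                         *)
Definition exceptional_divisor (D : seq point) : Prop :=
  forall v, v \in D -> interior_vertex v.

(* D_v and D_w (v <> w) meet exactly when v and w span an edge. *)
Definition meets_within (D : seq point) (v w : point) : Prop :=
  [/\ v \in D, w \in D & exists tau tau', exceptional_curve tau tau' v w].

Definition connected_divisor (D : seq point) : Prop :=
  D <> [::] /\
  forall v w, v \in D -> w \in D -> clos_refl_trans _ (meets_within D) v w.

(* The curve of the edge from v to w is the intersection of D_v and D_w, so it *)
(* lies in D' exactly when v or w is listed in D.                              *)
Definition Gig_divisor (D : seq point) : {set Irr} :=
  [set rho | `[< exists tau tau' v w,
    [/\ exceptional_curve tau tau' v w, (v \in D) || (w \in D)
      & rho \in Gig tau tau'] >]].

(* A coherent sheaf F on A^3 with H^0(F) = C[G] is given by three commuting    *)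
(* operators on C[G] (acting on row vectors), multiplication by the            *)
(* coordinates; equivariance is g (x_i s) = (g x_i) (g s).                     *)
Record constellation := Constellation {
  coord_mul : 'I_3 -> 'M[R[i]]_#|G|;
  coord_mulC : forall i j,
    coord_mul i *m coord_mul j = coord_mul j *m coord_mul i;
  coord_mul_equivariant : forall i g, g \in G ->
    coord_mul i *m regular_repr R[i] G g =
      rG g i i *: (regular_repr R[i] G g *m coord_mul i)
}.

(* U is identified with its row space *)
Definition equivariant_subsheaf (F : constellation) (U : 'M[R[i]]_#|G|) : bool :=
  mxmodule (regular_repr R[i] G) U && [forall i, stablemx U (coord_mul F i)].

Definition in_Theta (theta : {ffun Irr -> rat}) : Prop :=
  \sum_rho theta rho = 0.

(* (U :&: rho)%MS is the rho-isotypic component of U. *)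
Definition multiplicity (rho : Irr) (U : 'M[R[i]]_#|G|) : nat :=
  (\rank (U :&: rho)%MS %/ irr_degree rho)%N.

Definition theta_rep (theta : {ffun Irr -> rat}) (U : 'M[R[i]]_#|G|) : rat :=
  \sum_rho theta rho * (multiplicity rho U)%:R.

Definition proper_nonzero (U : 'M[R[i]]_#|G|) : Prop :=
  (U != 0) /\ ~~ row_full U.

Definition stable (theta : {ffun Irr -> rat}) (F : constellation) : Prop :=
  forall U, equivariant_subsheaf F U -> proper_nonzero U ->
    0 < theta_rep theta U.

Definition semistable (theta : {ffun Irr -> rat}) (F : constellation) : Prop :=
  forall U, equivariant_subsheaf F U -> proper_nonzero U ->
    0 <= theta_rep theta U.

Definition generic (theta : {ffun Irr -> rat}) : Prop :=
  in_Theta theta /\ forall F, semistable theta F -> stable theta F.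

(* Chambers are the connected components of the generic locus.  The walls are  *)
(* closed rational polyhedral cones, finite in number, so components are       *)
(* joined by polygonal paths of rational generic parameters.                   *)
Definition generic_segment (theta theta' : {ffun Irr -> rat}) : Prop :=
  forall t : rat, 0 <= t <= 1 ->
    generic [ffun rho => (1 - t) * theta rho + t * theta' rho].

Definition same_chamber (theta theta' : {ffun Irr -> rat}) : Prop :=
  generic theta /\ clos_refl_trans _ generic_segment theta theta'.

(* [1 Irr] is the trivial representation. *)
Definition chamber0 (theta : {ffun Irr -> rat}) : Prop :=
  exists theta0 : {ffun Irr -> rat},
    [/\ in_Theta theta0, forall rho : Irr, rho != [1 Irr]%irr -> 0 < theta0 rho
      & same_chamber theta0 theta].

End Definitions.

(* Main.v *)
Require Import Defs.
From mathcomp Require Import all_boot all_order all_algebra all_fingroup.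
From mathcomp Require Import all_solvable all_character.
From mathcomp Require Import boolp reals complex.
From mathcomp Require Import ring lra.

(* Crossing the edges at an interior vertex v, the monomial of rho never       *)
(* changes exactly when a single monomial of character rho has least weight at *)
(* v.  By connectedness, the characters outside Gig(D') are therefore those    *)
(* for which one and the same monomial is the only one of least weight at all  *)
(* vertices of D'.  Divisors of such a monomial have the same property, so     *)
(* for a triangle tau touching D' the characters in Gig(D') span a             *)
(* G-equivariant submodule of the cluster Z_tau.  It is nonzero, since v would *)
(* otherwise be an inner point of a cell, and does not contain 1.  As Z_tau is *)
(* generated by 1 it is stable for theta positive on nontrivial characters,    *)
(* and stability persists along generic segments, hence on all of the chamber. *)

Set Implicit Arguments.
Unset Strict Implicit.
Unset Printing Implicit Defensive.

Import Order.TTheory GRing.Theory Num.Theory.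
Local Open Scope ring_scope.
Local Open Scope complex_scope.

(** * Weights and the plane of the junior simplex *)

(** Fix a triangle [tau0] with a vertex in D'. The submodule of the cluster of [tau0] spanned by the
    characters in Gig(D') has the sum of the theorem as its theta-value ([theta_rep_sum_irr]), so it
    suffices that it is a proper nonzero subsheaf of a stable constellation.

    The combinatorial part replaces edges by monomials of least weight ([minimal]). By
    [edge_of_two_minimal], two least monomials of character rho at an interior vertex force an edge
    there across which the monomial of rho changes. With connectedness this gives [Gig_divisorP]:
    rho lies in Gig(D') exactly when, at some vertex of D', a monomial other than r_{rho, tau0} is
    least. In this form [Gig_divisor_closed] (stability under the coordinates) and
    [principal_notin_Gig_divisor] (properness) are comparisons of weights; [vertex_has_edge] gives
    nonvanishing.

    The stability part is [cluster_stable], for theta positive on nontrivial characters, and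
    [stable_segment], which carries it through the chamber. *)

(** Finitely many strict inequalities share a radius: a positive [x j] tolerates [|s|] up to
    [x j / (|y j| + 1)], where the 1 keeps the denominator positive when [y j] vanishes. *)
Lemma perturbation_radius (I : finType) (x y : I -> rat) :
  exists2 e, 0 < e &
  forall i s, `|s| <= e -> 0 < x i -> 0 < x i + s * y i.
Proof.
suff [e e0 He]: exists2 e, 0 < e & forall i s, i \in enum I ->
    `|s| <= e -> 0 < x i -> 0 < x i + s * y i.
  by exists e => // i s; apply: He; rewrite mem_enum.
elim: (enum I) => [|j r [e e0 He]]; first by exists 1.
have [x0|x0] := ltP 0 (x j); last first.
  exists e => // i s; rewrite inE => /orP[/eqP->|ir]; last exact: He.
  by move=> _ h; rewrite ltNge x0 in h.
have y0 : 0 < `|y j| + 1 by rewrite ltr_wpDl.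
have xy0 : 0 < x j / (`|y j| + 1) by rewrite divr_gt0.
exists (Num.min e (x j / (`|y j| + 1))); first by rewrite lt_min e0.
move=> i s; rewrite inE le_min => /orP[/eqP->|ir] /andP[se sxy]; last exact: He.
move=> _; rewrite -ltrBlDr sub0r.
apply: (le_lt_trans (ler_norm _)); rewrite normrN normrM.
apply: (@le_lt_trans _ _ (x j / (`|y j| + 1) * `|y j|)).
  by rewrite ler_wpM2r.
by rewrite mulrAC -mulrA gtr_pMr // ltr_pdivrMr // mul1r ltrDl.
Qed.

(** The ratio test of linear programming: the first constraint to become tight is a decreasing one
    with [a j / - b j] smallest. It finds the far end of an edge, the first tie of two monomials and
    the first loss of stability. *)
Lemma exit_time (I : finType) (a b : I -> rat) (s0 : rat) (j0 : I) :
  (forall i, 0 <= a i + s0 * b i) -> b j0 < 0 ->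
  exists2 s, s0 <= s & (forall i, 0 <= a i + s * b i) /\
  exists2 j, b j < 0 & a j + s * b j = 0.
Proof.
move=> ab0 bj0.
case: (@arg_minP _ _ _ j0 (fun j => b j < 0) (fun j => a j / - b j)) => //.
move=> j bj jmin; have bj' : b j != 0 by rewrite lt_eqF.
have s0j : s0 <= a j / - b j.
  by rewrite ler_pdivlMr ?oppr_gt0 // mulrN -subr_ge0 opprK.
exists (a j / - b j) => //; split; last first.
  by exists j => //; rewrite invrN mulrN mulNr -mulrA mulVf // mulr1 subrr.
move=> i; have [bi|bi] := ltP (b i) 0; last first.
  by apply: (le_trans (ab0 i)); rewrite lerD2l ler_wpM2r.
have /= := jmin i bi; rewrite ler_pdivlMr ?oppr_gt0 //.
by rewrite mulrN -subr_ge0 opprK.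
Qed.

Lemma sum3E (V : nmodType) (F : 'I_3 -> V) : \sum_i F i = F 0 + F 1 + F 2%:R.
Proof.
rewrite !big_ord_recl big_ord0 addr0 addrA.
by congr (_ + F _ + F _); apply/val_inj.
Qed.

Lemma ord3_ind (P : 'I_3 -> Prop) : P 0 -> P 1 -> P 2%:R -> forall i, P i.
Proof.
move=> P0 P1 P2 [[|[|[|//]]] i].
- by rewrite (_ : Ordinal i = 0) //; apply/val_inj.
- by rewrite (_ : Ordinal i = 1) //; apply/val_inj.
- by rewrite (_ : Ordinal i = 2%:R) //; apply/val_inj.
Qed.

Definition coord_sum (u : point) : rat := \sum_i u 0 i.

Lemma coord_sumD u v : coord_sum (u + v) = coord_sum u + coord_sum v.
Proof.
by rewrite /coord_sum -big_split; apply: eq_bigr => i _; rewrite mxE.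
Qed.

Lemma coord_sumZ a v : coord_sum (a *: v) = a * coord_sum v.
Proof. by rewrite /coord_sum mulr_sumr; apply: eq_bigr => i _; rewrite mxE. Qed.

Lemma weightD u v m : weight (u + v) m = weight u m + weight v m.
Proof.
by rewrite /weight -big_split; apply: eq_bigr => i _; rewrite mxE mulrDl.
Qed.

Lemma weightZ a v m : weight (a *: v) m = a * weight v m.
Proof.
by rewrite /weight mulr_sumr; apply: eq_bigr => i _; rewrite mxE mulrA.
Qed.

Definition mono_mul (m n : monomial) : monomial := [ffun i => (m i + n i)%N].

Lemma weightM u m n : weight u (mono_mul m n) = weight u m + weight u n.
Proof.
rewrite /weight -big_split; apply: eq_bigr => i _.
by rewrite ffunE natrD mulrDr.
Qed.

(* d x (1, 1, 1): together with d it spans the plane of coordinate sum 0. *)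
Definition turn (d : point) : point :=
  \row_i (d 0 (i + 1) - d 0 (i + 2%:R)).

Lemma turnE d :
  (turn d 0 0 = d 0 1 - d 0 2%:R) *
  (turn d 0 1 = d 0 2%:R - d 0 0) * (turn d 0 2%:R = d 0 0 - d 0 1).
Proof.
have h3 : 1 + 2%:R = 0 :> 'I_3 by apply/val_inj.
have h4 : 2%:R + 2%:R = 1 :> 'I_3 by apply/val_inj.
by rewrite !mxE !add0r h3 h4 (addrC 2%:R) h3.
Qed.

Lemma coord_sum_turn d : coord_sum (turn d) = 0.
Proof. by rewrite /coord_sum sum3E !turnE; ring. Qed.

Lemma sum0_neq0 d : coord_sum d = 0 -> d != 0 -> (d 0 0 != 0) || (d 0 1 != 0).
Proof.
rewrite /coord_sum sum3E => d0; apply: contraNT.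
rewrite negb_or !negbK => /andP[/eqP a /eqP b].
apply/eqP/rowP; apply: ord3_ind; rewrite ?mxE //.
by move: d0; rewrite a b !add0r.
Qed.

Lemma monomial_eq_natr (m n : monomial) : (m 0)%:R = (n 0)%:R :> rat ->
  (m 1)%:R = (n 1)%:R :> rat -> (m 2%:R)%:R = (n 2%:R)%:R :> rat ->
  m = n.
Proof.
have mn (i : 'I_3) : (m i)%:R = (n i)%:R :> rat -> m i = n i.
  by move/eqP; rewrite eqr_nat => /eqP.
by move=> *; apply/ffunP; apply: ord3_ind; apply: mn.
Qed.

(** The vectors [d] and [turn d] span the plane of coordinate sum 0 and [v] lies off it, so the
    three weights determine the exponents. *)
Lemma monomial_eq_of_weights v d m n :
  coord_sum v = 1 -> coord_sum d = 0 -> d != 0 ->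
  weight v m = weight v n -> weight d m = weight d n ->
  weight (turn d) m = weight (turn d) n -> m = n.
Proof.
move=> v1 d0 dN0; have := sum0_neq0 d0 dN0; move: v1 d0.
rewrite /weight /coord_sum !sum3E !turnE.
move: (v 0 0) (v 0 1) (v 0 2%:R) (d 0 0) (d 0 1) (d 0 2%:R).
move=> v0 v1 v2 d0 d1 d2 v_1 d_0 dN vE dE eE.
have {}d_0 : d2 = - d0 - d1 by lra.
have {}v_1 : v2 = 1 - v0 - v1 by lra.
subst d2 v2.
suff [q0 q1 q2]: [/\ (m 0)%:R = (n 0)%:R :> rat, (m 1)%:R = (n 1)%:R :> rat
   & (m 2%:R)%:R = (n 2%:R)%:R :> rat].
  exact: monomial_eq_natr.
move: vE dE eE.
move: (m 0)%:R (m 1)%:R (m 2%:R)%:R (n 0)%:R (n 1)%:R (n 2%:R)%:R.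
move=> a0 a1 a2 b0 b1 b2 vE dE eE.
pose x := (a0 - b0) - (a2 - b2); pose y := (a1 - b1) - (a2 - b2).
(* Up to the factor -2, this positive definite form is the determinant of the equations [dE'] and
   [eE'] in [x] and [y]. *)
have D : d0 ^+ 2 + d0 * d1 + d1 ^+ 2 != 0.
  rewrite gt_eqF //; case/orP: dN => dN.
    have := exprn_even_gt0 d0 (isT : ~~ odd 2); rewrite dN /= => h.
    by have := sqr_ge0 (d0 / 2%:R + d1); nra.
  have := exprn_even_gt0 d1 (isT : ~~ odd 2); rewrite dN /= => h.
  by have := sqr_ge0 (d1 / 2%:R + d0); nra.
have dE' : d0 * x + d1 * y = 0 by rewrite /x /y; lra.
have eE' : (d0 + 2%:R * d1) * x - (2%:R * d0 + d1) * y = 0.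
  by rewrite /x /y; lra.
have x0 : x = 0.
  apply: (mulfI D); rewrite mulr0.
  apply: (mulfI (_ : 2%:R != 0)) => //.
  transitivity ((2%:R * d0 + d1) * (d0 * x + d1 * y) +
    d1 * ((d0 + 2%:R * d1) * x - (2%:R * d0 + d1) * y)); first by ring.
  by rewrite dE' eE' !mulr0 addr0.
have y0 : y = 0.
  apply: (mulfI D); rewrite mulr0.
  apply: (mulfI (_ : 2%:R != 0)) => //.
  transitivity ((d0 + 2%:R * d1) * (d0 * x + d1 * y) -
    d0 * ((d0 + 2%:R * d1) * x - (2%:R * d0 + d1) * y)); first by ring.
  by rewrite dE' eE' !mulr0 subr0.
have vE' : v0 * x + v1 * y + (a2 - b2) = 0 by rewrite /x /y; lra.
rewrite x0 y0 !mulr0 !add0r in vE'.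
by rewrite /x /y in x0 y0; split; lra.
Qed.

(** If [a - v] were not a multiple of [d], the two would span the plane of coordinate sum 0; then
    [m] and [n] would also tie along [turn d] and be equal. *)
Lemma on_line v d a m n :
  coord_sum v = 1 -> coord_sum d = 0 -> d != 0 -> coord_sum a = 1 -> m <> n ->
  weight v m = weight v n -> weight d m = weight d n ->
  weight a m = weight a n -> exists s, a = v + s *: d.
Proof.
move=> v1 d0 dN0 a1 mn vE dE aE.
pose f := a - v.
have f0 : coord_sum f = 0.
  by rewrite /f -scaleN1r coord_sumD coord_sumZ v1 a1 mulN1r subrr.
have fE : weight f m = weight f n.
  by rewrite /f -scaleN1r !weightD !weightZ vE aE.
suff [s fs]: exists s, f = s *: d by exists s; rewrite -fs /f addrC subrK.
clearbody f.
have detE : f 0 0 * d 0 1 = f 0 1 * d 0 0.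
  apply/eqP/negPn/negP => detN; apply: mn.
  have detN' : f 0 0 * d 0 1 - f 0 1 * d 0 0 != 0 by rewrite subr_eq0.
  apply: (monomial_eq_of_weights v1 d0 dN0 vE dE).
  move: fE dE f0 d0 {detN} detN'; rewrite /weight /coord_sum !sum3E !turnE.
  move: (f 0 0) (f 0 1) (f 0 2%:R) (d 0 0) (d 0 1) (d 0 2%:R).
  move=> f0 f1 f2 d0 d1 d2 fE dE f_0 d_0.
  have {}d_0 : d2 = - d0 - d1 by lra.
  have {}f_0 : f2 = - f0 - f1 by lra.
  subst d2 f2; move: fE dE.
  move: (m 0)%:R (m 1)%:R (m 2%:R)%:R (n 0)%:R (n 1)%:R (n 2%:R)%:R.
  move=> a0 a_1 a2 b0 b1 b2 fE dE detN.
  pose x := (a0 - b0) - (a2 - b2); pose y := (a_1 - b1) - (a2 - b2).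
  have dE' : d0 * x + d1 * y = 0 by rewrite /x /y; lra.
  have fE' : f0 * x + f1 * y = 0 by rewrite /x /y; lra.
  have x0 : x = 0.
    apply: (mulfI detN); rewrite mulr0.
    transitivity (d1 * (f0 * x + f1 * y) - f1 * (d0 * x + d1 * y)).
      by ring.
    by rewrite dE' fE' !mulr0 subrr.
  have y0 : y = 0.
    apply: (mulfI detN); rewrite mulr0.
    transitivity (f0 * (d0 * x + d1 * y) - d0 * (f0 * x + f1 * y)).
      by ring.
    by rewrite dE' fE' !mulr0 subrr.
  apply/eqP; rewrite -subr_eq0; apply/eqP.
  transitivity ((d1 - (- d0 - d1)) * x + (- d0 - d1 - d0) * y).
    by rewrite /x /y; ring.
  by rewrite x0 y0 !mulr0 addr0.
have third (u : point) : coord_sum u = 0 -> u 0 2%:R = - u 0 0 - u 0 1.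
  by rewrite /coord_sum sum3E => h; lra.
case/orP: (sum0_neq0 d0 dN0) => dN.
  exists (f 0 0 / d 0 0).
  have e1 : f 0 1 = f 0 0 / d 0 0 * d 0 1 by rewrite mulrAC detE mulfK.
  apply/rowP; apply: ord3_ind; rewrite mxE ?divfK // !third // e1.
  by field.
exists (f 0 1 / d 0 1).
have e1 : f 0 0 = f 0 1 / d 0 1 * d 0 0 by rewrite mulrAC -detE mulfK.
apply/rowP; apply: ord3_ind; rewrite mxE ?divfK // !third // e1.
by field.
Qed.

(** The direction is the cross product of the exponent difference [q] with (1, 1, 1), hence
    orthogonal to both. It is nonzero because [q] is no multiple of (1, 1, 1): [v] would give it
    that multiple as weight, whereas [m] and [n] tie at [v]. *)
Lemma exists_tie_direction v m n :
  coord_sum v = 1 -> m <> n -> weight v m = weight v n ->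
  exists k : point, [/\ coord_sum k = 0, k != 0 & weight k m = weight k n].
Proof.
move=> v1 mn vE.
pose q : point := \row_i ((m i)%:R - (n i)%:R).
exists (turn q); split; first exact: coord_sum_turn.
  apply/eqP => /rowP q0; apply: mn.
  have := q0 0; have := q0 1; have := q0 2%:R; rewrite !turnE !mxE.
  move: v1 vE; rewrite /weight /coord_sum !sum3E => v1 vE q2 q1 q_0.
  suff [e0 e1 e2]: [/\ (m 0)%:R = (n 0)%:R :> rat, (m 1)%:R = (n 1)%:R :> rat
     & (m 2%:R)%:R = (n 2%:R)%:R :> rat].
    exact: monomial_eq_natr.
  move: v1 vE q2 q1 q_0.
  move: (m 0)%:R (m 1)%:R (m 2%:R)%:R (n 0)%:R (n 1)%:R (n 2%:R)%:R.
  move: (v 0 0) (v 0 1) (v 0 2%:R).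
  move=> v0 v_1 v2 a0 a1 a2 b0 b1 b2 v1 vE q2 q1 q_0.
  have E1 : a1 = b1 + (a0 - b0) by lra.
  have E2 : a2 = b2 + (a0 - b0) by lra.
  have e0 : a0 = b0.
    have vE' : (v0 + v_1 + v2) * (a0 - b0) = 0.
      transitivity ((v0 * a0 + v_1 * (b1 + (a0 - b0)) + v2 * (b2 + (a0 - b0)))
        - (v0 * b0 + v_1 * b1 + v2 * b2)); first by ring.
      by rewrite -E1 -E2 vE subrr.
    by move: vE'; rewrite v1 mul1r; lra.
  by rewrite E1 E2 e0; split; ring.
rewrite /weight !sum3E !turnE !mxE; ring.
Qed.

Lemma sum0_neg d : coord_sum d = 0 -> d != 0 -> exists i, d 0 i < 0.
Proof.
move=> d0 dN; apply: contrapT => hn.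
have dge i : 0 <= d 0 i.
  by rewrite leNgt; apply/negP => h; apply: hn; exists i.
case/eqP: dN; apply/rowP => i; rewrite mxE.
by apply/(psumr_eq0P (P := xpredT)) => //; rewrite -[RHS]d0.
Qed.

(** * Clusters, cells and edges *)

Section Clusters.

Variables (R : realType) (gT : finGroupType) (G : {group gT}).
Variable rG : mx_representation R[i] G 3.
Hypothesis rG_diag : {in G, forall g, is_diag_mx (rG g)}.

Implicit Types (m n : monomial) (rho : Irr R G) (u v : point).
Implicit Types (tau : monomial_cluster rG).

Definition mono_char m (g : gT) : R[i] := \prod_i rG g i i ^+ m i.

Lemma mono_charM m n g :
  mono_char (mono_mul m n) g = mono_char m g * mono_char n g.
Proof.
by rewrite /mono_char -big_split; apply: eq_bigr => i _; rewrite ffunE exprD.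
Qed.

Lemma has_characterP m rho :
  reflect {in G, forall g, mono_char m g = Defs.irr_char rho g}
    (has_character rG m rho).
Proof. exact: (iffP 'forall_in_eqP). Qed.

Lemma has_character_eq m n rho : {in G, mono_char m =1 mono_char n} ->
  has_character rG m rho = has_character rG n rho.
Proof.
by move=> mn; apply/has_characterP/has_characterP => h g Gg;
  rewrite -(h g Gg) mn.
Qed.

Lemma same_char m n rho : has_character rG m rho -> has_character rG n rho ->
  {in G, mono_char m =1 mono_char n}.
Proof. by move=> /has_characterP a /has_characterP b g Gg; rewrite a ?b. Qed.

Lemma has_characterMl k m n rho rho' :
  has_character rG m rho -> has_character rG n rho ->
  has_character rG (mono_mul k m) rho' -> has_character rG (mono_mul k n) rho'.
Proof.
move=> hm hn; rewrite (has_character_eq (n := mono_mul k n)) // => g Gg.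
by rewrite !mono_charM (same_char hm hn Gg).
Qed.

Lemma rG_expg g i k : g \in G -> rG (g ^+ k)%g i i = rG g i i ^+ k.
Proof.
move=> Gg; elim: k => [|k IHk]; first by rewrite expg0 repr_mx1 mxE eqxx.
rewrite expgS repr_mxM ?groupX // mxE (bigD1 i) //= big1 ?addr0 ?IHk ?exprS //.
move=> j ji; suff -> : rG g i j = 0 by rewrite mul0r.
have /is_diag_mxP := rG_diag Gg; apply; rewrite eq_sym; exact: ji.
Qed.

(** The weights of the coordinates are [#|G|]-th roots of unity, so reducing exponents modulo [#|G|]
    keeps the character and raises no weight at nonnegative points. Minimality thus becomes a finite
    test on box monomials. *)
Definition box := {ffun 'I_3 -> 'I_#|G|}.
Definition of_box (b : box) : monomial := [ffun i => val (b i)].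
Definition to_box m : box :=
  [ffun i => Ordinal (ltn_pmod (m i) (cardG_gt0 G))].

Lemma of_boxK m : (forall i, (m i < #|G|)%N) -> of_box (to_box m) = m.
Proof. by move=> h; apply/ffunP => i; rewrite !ffunE /= modn_small. Qed.

Lemma to_box_char m rho :
  has_character rG (of_box (to_box m)) rho = has_character rG m rho.
Proof.
apply: has_character_eq => g Gg; apply: eq_bigr => i _; rewrite !ffunE /=.
have E : rG g i i ^+ #|G| = 1.
  by rewrite -rG_expg // expg_cardG // repr_mx1 mxE eqxx.
by rewrite [in RHS](divn_eq (m i) #|G|) exprD mulnC exprM E expr1n mul1r.
Qed.

Lemma to_box_weight u m : (forall i, 0 <= u 0 i) ->
  weight u (of_box (to_box m)) <= weight u m.
Proof.
move=> u0; apply: ler_sum => i _; apply: ler_wpM2l => //.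
by rewrite !ffunE ler_nat leq_mod.
Qed.

Lemma to_box_weight_lt u m : (forall i, 0 < u 0 i) ->
  of_box (to_box m) != m -> weight u (of_box (to_box m)) < weight u m.
Proof.
move=> u0 ne; have [/forallP h|] := boolP [forall i, (m i < #|G|)%N].
  by rewrite of_boxK ?eqxx in ne.
case/forallPn => i; rewrite -leqNgt => mi.
rewrite /weight (bigD1 i) //= [ltRHS](bigD1 i) //=; apply: ltr_leD.
  rewrite ltr_pM2l // ltr_nat !ffunE /=.
  by apply: leq_trans mi; rewrite ltn_mod cardG_gt0.
apply: ler_sum => j _; apply: ler_wpM2l; first exact: ltW.
by rewrite !ffunE ler_nat leq_mod.
Qed.

(** * Monomials of least weight and cells *)

Definition minimal u rho m :=
  has_character rG m rho /\
  forall n, has_character rG n rho -> weight u m <= weight u n.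

Lemma minimal_tie u rho m n :
  minimal u rho m -> minimal u rho n -> weight u m = weight u n.
Proof.
by move=> [cm hm] [cn hn]; apply/eqP; rewrite eq_le hm ?hn.
Qed.

Lemma minimal_eq u rho m n : minimal u rho m -> has_character rG n rho ->
  weight u n <= weight u m -> minimal u rho n.
Proof. by move=> [_ hm] cn nm; split=> // k /hm; apply: le_trans. Qed.

Lemma minimal_of_box u rho m : (forall i, 0 < u 0 i) -> minimal u rho m ->
  of_box (to_box m) = m.
Proof.
move=> u0 [cm hm]; apply/eqP; apply: contraT => /(to_box_weight_lt u0).
by rewrite ltNge hm // to_box_char.
Qed.

Lemma box_minimal u rho m : (forall i, 0 <= u 0 i) -> has_character rG m rho ->
  (forall b : box, has_character rG (of_box b) rho ->
     weight u m <= weight u (of_box b)) -> minimal u rho m.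
Proof.
move=> u0 cm h; split=> // n cn; apply: le_trans (to_box_weight n u0).
by apply: h; rewrite to_box_char.
Qed.

Lemma minimal_exists u rho n : (forall i, 0 <= u 0 i) ->
  has_character rG n rho -> exists m, minimal u rho m.
Proof.
move=> u0 cn; rewrite -to_box_char in cn.
case: (@arg_minP _ _ _ (to_box n)
  (fun b : box => has_character rG (of_box b) rho)
  (fun b => weight u (of_box b)) cn) => b cb hb.
by exists (of_box b); apply: box_minimal.
Qed.

Lemma repr_monomialP rho tau :
  ~~ cluster_ideal tau (repr_monomial rho tau) &&
  has_character rG (repr_monomial rho tau) rho.
Proof. exact: xchooseP (cluster_basis tau rho). Qed.

Lemma repr_monomial_char rho tau : has_character rG (repr_monomial rho tau) rho.
Proof. by case/andP: (repr_monomialP rho tau). Qed.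

Lemma repr_monomial_unique rho tau m :
  ~~ cluster_ideal tau m -> has_character rG m rho -> m = repr_monomial rho tau.
Proof.
move=> im cm; apply: (cluster_basis_unique (rho := rho) (m0 := tau)).
  by rewrite im.
exact: repr_monomialP.
Qed.

Lemma cellP tau u : cell tau u <->
  in_junior_simplex u /\ forall rho, minimal u rho (repr_monomial rho tau).
Proof.
split=> -[u1 h]; split=> // rho; last by case: (h rho).
by split; [exact: repr_monomial_char | exact: h].
Qed.

(** The ideal consists of the monomials beaten at [u] by another one of the same character: the
    initial ideal, for the weight [u], of the orbit of (1, 1, 1). Multiplying both competitors by
    one monomial preserves the defeat, and the undefeated ones are the unique least monomials. *)
Lemma cluster_of_generic u :
  (forall rho, exists2 m, has_character rG m rho &
     forall n, has_character rG n rho -> n != m -> weight u m < weight u n) ->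
  exists tau, forall rho n, has_character rG n rho ->
    n != repr_monomial rho tau -> weight u (repr_monomial rho tau) < weight u n.
Proof.
move=> gen.
pose I : pred monomial := fun m => `[< exists2 n,
  {in G, mono_char n =1 mono_char m} & weight u n < weight u m >].
have Iclosed m m' : (forall i, (m i <= m' i)%N) -> I m -> I m'.
  move=> mm' /asboolP[n nm wn]; apply/asboolP.
  pose k : monomial := [ffun i => (m' i - m i)%N].
  have m'E : m' = mono_mul k m by apply/ffunP => i; rewrite !ffunE subnK.
  exists (mono_mul k n); last by rewrite m'E !weightM ltrD2l.
  by move=> g Gg; rewrite m'E !mono_charM nm.
have Imin rho m : has_character rG m rho ->
    (forall n, has_character rG n rho -> n != m -> weight u m < weight u n) ->
    ~~ I m.
  move=> cm hm; apply/asboolP => -[n nm wn].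
  have [E|ne] := eqVneq n m; first by rewrite E ltxx in wn.
  move: (hm n); rewrite (has_character_eq rho nm) cm => /(_ isT ne).
  by rewrite ltNge ltW.
have Iuniq rho m n : ~~ I n && has_character rG n rho ->
    has_character rG m rho ->
    (forall n, has_character rG n rho -> n != m -> weight u m < weight u n) ->
    n = m.
  move=> /andP[In cn] cm hm; apply/eqP; apply: contraNT In => ne.
  apply/asboolP; exists m; last exact: hm.
  exact: same_char cm cn.
have Ibasis rho : exists m, ~~ I m && has_character rG m rho.
  by have [m cm hm] := gen rho; exists m; rewrite (Imin rho m) ?cm.
have Iuniq2 rho m m' : ~~ I m && has_character rG m rho ->
    ~~ I m' && has_character rG m' rho -> m = m'.
  have [n cn hn] := gen rho.
  by move=> /(Iuniq rho n) -> // /(Iuniq rho n) ->.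
exists (MonomialCluster Iclosed Ibasis Iuniq2) => rho n cn.
have [m cm hm] := gen rho.
set r := repr_monomial _ _; suff -> : r = m by exact: hm.
apply: (Iuniq rho) => //.
exact: (repr_monomialP rho (MonomialCluster _ _ _)).
Qed.

(** The two cells meet in a face of each. On [cell tau'] the monomial of [tau] is never lighter than
    that of [tau']; a tie at the midpoint [v] then forces ties at both ends, which therefore lie in
    [cell tau]. *)
Lemma vertex_transfer tau tau' v :
  vertex_of tau v -> cell tau' v -> vertex_of tau' v.
Proof.
move=> [/cellP[v1 cv] ext] cv'; split=> // a b ca cb vE.
suff sub c c' : cell tau' c -> cell tau' c' -> v = 2%:R^-1 *: (c + c') ->
    cell tau c.
  apply: (ext _ _ _ _ vE); first exact: (sub a b).
  by apply: (sub b a) => //; rewrite addrC.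
move=> /cellP[c1 hc] /cellP[_ hc'] {}vE; apply/cellP; split=> // rho.
apply: minimal_eq (hc rho) (repr_monomial_char _ _) _.
have /cellP[_ /(_ rho) h] := cv'.
have := minimal_tie (cv rho) h; rewrite vE !weightZ !weightD.
case: (hc' rho) => _ /(_ _ (repr_monomial_char rho tau)).
set x := weight c' _; set y := weight c' _; set z := weight c _.
set t := weight c _; lra.
Qed.

(** * Perturbing a point, and edges at an interior vertex *)

Lemma perturb v d : exists2 e, 0 < e &
  forall s, `|s| <= e ->
  ((forall i, 0 < v 0 i) -> forall i, 0 < (v + s *: d) 0 i) /\
  forall b b' : box, weight v (of_box b) < weight v (of_box b') ->
    weight (v + s *: d) (of_box b) < weight (v + s *: d) (of_box b').
Proof.
have [e1 e10 H1] := perturbation_radius (fun i => v 0 i) (fun i => d 0 i).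
have [e2 e20 H2] := perturbation_radius
  (fun p : box * box => weight v (of_box p.2) - weight v (of_box p.1))
  (fun p : box * box => weight d (of_box p.2) - weight d (of_box p.1)).
exists (Num.min e1 e2); first by rewrite lt_min e10.
move=> s; rewrite le_min => /andP[s1 s2]; split.
  by move=> v0 i; rewrite !mxE; apply: H1.
move=> b b' bb'; have := H2 (b, b') s s2; rewrite /= subr_gt0 => /(_ bb').
rewrite !weightD !weightZ.
set x := weight _ _; set y := weight _ _; set z := weight _ _.
set t := weight _ _; lra.
Qed.

(** Passing from [v] to a nearby [u] may break ties but reverses no strict comparison of box
    monomials; hence what is least at [u] was already least at [v]. *)
Definition specializes u v := forall b b' : box,
  weight v (of_box b) < weight v (of_box b') ->
  weight u (of_box b) < weight u (of_box b').

Lemma minimal_specializes u v rho m :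
  (forall i, 0 < u 0 i) -> (forall i, 0 <= v 0 i) -> specializes u v ->
  minimal u rho m -> minimal v rho m.
Proof.
move=> u0 v0 uv hm; have mE := minimal_of_box u0 hm.
case: hm => cm hm; apply: box_minimal => // b cb.
rewrite leNgt -mE; apply/negP => /uv.
by rewrite mE ltNge hm.
Qed.

Lemma simplex_shift v d s : in_junior_simplex v -> coord_sum d = 0 ->
  (forall i, 0 < (v + s *: d) 0 i) -> in_junior_simplex (v + s *: d).
Proof.
move=> [v0 v1] d0 h; split; first by move=> i; exact: ltW.
by rewrite -/(coord_sum _) coord_sumD coord_sumZ d0 mulr0 addr0.
Qed.

(* The triangles belong to v + e d + f turn d and v + e d - f turn d, where    *)
(* 0 < f << e << 1; the edge ends where the ray v + R+ d leaves the cells.     *)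
Lemma edge_of_tie tau0 v d rho m m' :
  vertex_of tau0 v -> (forall i, 0 < v 0 i) -> coord_sum d = 0 -> d != 0 ->
  minimal v rho m -> minimal v rho m' -> m != m' ->
  weight d m = weight d m' ->
  (forall n, minimal v rho n -> weight d m <= weight d n) ->
  exists tau tau' w, exceptional_curve tau tau' v w /\ rho \in Gig tau tau'.
Proof.
move=> ext v0 d0 dN hm hm' mm' dmm' dmin.
have [[simv _] _] := ext.
have v1 : coord_sum v = 1 by case: simv.
have [e e0 pert_e] := perturb v d.
have [|pos_p pv] := pert_e e; first by rewrite gtr0_norm.
have {}pos_p := pos_p v0; have simp := simplex_shift simv d0 pos_p.
set p := v + e *: d in pos_p pv simp.
have pE : p = v + e *: d by [].
clearbody p.
have vge i : 0 <= v 0 i by exact: ltW.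
have pge i : 0 <= p 0 i by exact: ltW.
(* First-order test: among the monomials least at [v], those of least slope along [d] remain least
   at [p]. *)
have minp n : minimal v rho n -> weight d n = weight d m -> minimal p rho n.
  move=> hn dn; have nE := minimal_of_box v0 hn.
  have cn : has_character rG n rho by case: hn.
  apply: box_minimal => // b cb.
  have [h|h] := ltP (weight v n) (weight v (of_box b)).
    by apply/ltW; rewrite -nE; apply: pv; rewrite nE.
  have hb : minimal v rho (of_box b) by apply: minimal_eq hn _ _.
  rewrite pE !weightD !weightZ (minimal_tie hn hb) lerD2l ler_pM2l //.
  by rewrite dn; exact: dmin.
have [f f0 pert_f] := perturb p (turn d).
have side s : `|s| = f -> exists2 tau : monomial_cluster rG, is_triangle tau &
    forall rho', minimal (p + s *: turn d) rho' (repr_monomial rho' tau).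
  move=> sf; have [|pos_u up] := pert_f s; first by rewrite sf.
  have {}pos_u := pos_u pos_p.
  have simu := simplex_shift simp (coord_sum_turn d) pos_u.
  set u := p + s *: turn d in pos_u up simu *.
  have uE : u = p + s *: turn d by [].
  clearbody u.
  have uge i : 0 <= u 0 i by exact: ltW.
  have [tau htau] : exists tau, forall rho' n, has_character rG n rho' ->
      n != repr_monomial rho' tau ->
      weight u (repr_monomial rho' tau) < weight u n.
    apply: cluster_of_generic => rho'.
    have [n hn] := minimal_exists uge (repr_monomial_char rho' tau0).
    exists n; first by case: hn.
    (* A second least monomial [k] at [u] is also least at [p] and at [v], so it ties with [n] at
       [v], along [d] and along [turn d], and equals [n]. *)
    move=> k ck; rewrite ltNge; apply: contraNN => kn.
    have hk := minimal_eq hn ck kn.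
    have hkp := minimal_specializes pos_u pge up hk.
    have hnp := minimal_specializes pos_u pge up hn.
    have hkv := minimal_specializes pos_p vge pv hkp.
    have hnv := minimal_specializes pos_p vge pv hnp.
    have tu := minimal_tie hk hn; have tp := minimal_tie hkp hnp.
    have tv := minimal_tie hkv hnv; apply/eqP.
    apply: (monomial_eq_of_weights v1 d0 dN tv).
      move: tp; rewrite pE !weightD !weightZ tv => /addrI.
      by apply: mulfI; rewrite gt_eqF.
    move: tu; rewrite uE !weightD !weightZ tp => /addrI.
    by apply: mulfI; rewrite -normr_eq0 sf gt_eqF.
  exists tau => [|rho'].
    by exists u.
  split; first exact: repr_monomial_char.
  move=> n cn; have [->//|ne] := eqVneq n (repr_monomial rho' tau).
  exact/ltW/htau.
have spec s u : `|s| = f -> u = p + s *: turn d ->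
    (forall i, 0 < u 0 i) /\ specializes u p.
  move=> sf ->; have [|h1 h2] := pert_f s; first by rewrite sf.
  by split; [exact: h1 | exact: h2].
have nf : `|f| = f by rewrite gtr0_norm.
have nnf : `|- f| = f by rewrite normrN.
have [tau tri hu] := side f nf.
have [tau' tri' hu'] := side (- f) nnf.
have [pos_u up] := spec f _ nf erefl.
have [pos_u' up'] := spec (- f) _ nnf erefl.
have hp rho' := minimal_specializes pos_u pge up (hu rho').
have hp' rho' := minimal_specializes pos_u' pge up' (hu' rho').
have hv rho' := minimal_specializes pos_p vge pv (hp rho').
have hv' rho' := minimal_specializes pos_p vge pv (hp' rho').
have cp : cell tau (v + e *: d) by rewrite -pE; apply/cellP.
have cv : cell tau v by apply/cellP.
have cv' : cell tau' v by apply/cellP.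
have dtie rho' : weight d (repr_monomial rho' tau) =
    weight d (repr_monomial rho' tau').
  have := minimal_tie (hp rho') (hp' rho').
  rewrite pE !weightD !weightZ (minimal_tie (hv rho') (hv' rho')) => /addrI.
  by apply: mulfI; rewrite gt_eqF.
(* Were the monomial of [rho] the same on both sides, one of [m], [m'] would differ from it and tie
   with it at [p]. Being no lighter on either side, it would tie along [turn d] too, and so coincide
   with it. *)
have gig : rho \in Gig tau tau'.
  rewrite inE; apply/negP => /eqP rr.
  have [n [hn dn nr]] : exists n, [/\ minimal v rho n, weight d n = weight d m
      & n <> repr_monomial rho tau].
    have [E|/eqP ne] := eqVneq m (repr_monomial rho tau); last by exists m.
    by exists m'; split=> // E'; rewrite E E' eqxx in mm'.
  have hnp := minp n hn dn.
  have tp := minimal_tie hnp (hp rho).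
  have tv := minimal_tie hn (hv rho).
  have td : weight d n = weight d (repr_monomial rho tau).
    move: tp; rewrite pE !weightD !weightZ tv => /addrI.
    by apply: mulfI; rewrite gt_eqF.
  apply: nr; apply: (monomial_eq_of_weights v1 d0 dN) => //.
  have cn : has_character rG n rho by case: hn.
  have [_ /(_ n cn)] := hu rho; have [_ /(_ n cn)] := hu' rho.
  rewrite -rr !weightD !weightZ tp !mulNr !lerD2l lerN2 !ler_pM2l // => h1 h2.
  by apply/eqP; rewrite eq_le h1.
have [i di] := sum0_neg d0 dN.
(* The inequalities of [cell tau] on the ray [v + t *: d], in the form [0 <= a k + t * c k]; a box
   monomial of the wrong character contributes the void constraint 0. The negative coordinate [i] of
   [d] makes the ray leave the cell. *)
pose a (k : 'I_3 + Irr R G * box) : rat := match k with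
  | inl i => v 0 i
  | inr (rho', b) => if has_character rG (of_box b) rho' then
      weight v (of_box b) - weight v (repr_monomial rho' tau) else 0
  end.
pose c (k : 'I_3 + Irr R G * box) : rat := match k with
  | inl i => d 0 i
  | inr (rho', b) => if has_character rG (of_box b) rho' then
      weight d (of_box b) - weight d (repr_monomial rho' tau) else 0
  end.
have cellE t : cell tau (v + t *: d) <-> forall k, 0 <= a k + t * c k.
  split.
    move=> /cellP[[h _] ht] [j|[rho' b]] /=; first by have := h j; rewrite !mxE.
    case: ifP => cb; last by rewrite mulr0 addr0.
    have [_ /(_ _ cb)] := ht rho'; rewrite !weightD !weightZ.
    set x := weight _ _; set y := weight _ _; set z := weight _ _.
    set q := weight _ _; lra.
  move=> h.
  have ge j : 0 <= (v + t *: d) 0 j by have := h (inl j); rewrite !mxE.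
  apply/cellP; split.
    by split=> //; rewrite -/(coord_sum _) coord_sumD coord_sumZ d0 mulr0 addr0.
  move=> rho'; apply: box_minimal => //; first exact: repr_monomial_char.
  move=> b cb; have := h (inr (rho', b)); rewrite /= cb !weightD !weightZ.
  set x := weight _ _; set y := weight _ _; set z := weight _ _.
  set q := weight _ _; lra.
have [t et [ht [k ck tk]]] :=
  exit_time (s0 := e) (proj1 (cellE e) cp) (di : c (inl i) < 0).
have cw : cell tau (v + t *: d) by apply/cellE.
have t0 : 0 < t by exact: lt_le_trans et.
have tmax t' : cell tau (v + t' *: d) -> t' <= t.
  move=> /cellE /(_ k); rewrite -tk lerD2l leNgt => h.
  by rewrite leNgt; apply: contra h => h; rewrite ltr_nM2r.
have cw' : cell tau' (v + t *: d).
  have /cellP[simw hw] := cw; apply/cellP; split=> // rho'.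
  apply: minimal_eq (hw rho') (repr_monomial_char _ _) _.
  by rewrite !weightD !weightZ dtie (minimal_tie (hv rho') (hv' rho')).
(* The tie at the exit point of the monomials of [rho] in [tau] and [tau'] forces ties at [x] and
   [y], so both lie on the line through [v]. Neither lies beyond [t], and their midpoint is at
   [t]. *)
have vtxw : vertex_of tau (v + t *: d).
  split=> // x y cx cy wE.
  have online z : cell tau z ->
      weight z (repr_monomial rho tau) = weight z (repr_monomial rho tau') ->
      exists s, z = v + s *: d.
    move=> [[_ z1] _]; apply: (on_line v1 d0 dN z1) => //.
      by move: gig; rewrite inE => /eqP.
    exact: minimal_tie (hv rho) (hv' rho).
  have /cellP[_ /(_ rho) [_ /(_ _ (repr_monomial_char rho tau'))]] := cx.
  have /cellP[_ /(_ rho) [_ /(_ _ (repr_monomial_char rho tau'))]] := cy.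
  have /cellP[_ /(_ rho) hw] := cw; have /cellP[_ /(_ rho) hw'] := cw'.
  have := minimal_tie hw hw'; rewrite wE !weightZ !weightD => tie ly lx.
  have [s xs] : exists s, x = v + s *: d.
    apply: online => //; move: tie ly lx.
    set q1 := weight _ _; set q2 := weight _ _; set q3 := weight _ _.
    set q4 := weight _ _; lra.
  have [s' ys] : exists s, y = v + s *: d.
    apply: online => //; move: tie ly lx.
    set q1 := weight _ _; set q2 := weight _ _; set q3 := weight _ _.
    set q4 := weight _ _; lra.
  have st : s <= t by apply: tmax; rewrite -xs.
  have s't : s' <= t by apply: tmax; rewrite -ys.
  have [j dj] : exists j, d 0 j != 0.
    by case/orP: (sum0_neq0 d0 dN); [exists 0 | exists 1].
  have := congr1 (fun w : point => w 0 j) wE; rewrite /= xs ys !mxE => E.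
  have : (2%:R * t - s - s') * d 0 j = 0 by lra.
  move/eqP; rewrite mulf_eq0 (negPf dj) orbF => /eqP E'.
  by congr (v + _ *: d); lra.
exists tau, tau', (v + t *: d); split=> //; split=> //.
- move=> II; move: gig; rewrite inE => /eqP; apply.
  apply: repr_monomial_unique; last exact: repr_monomial_char.
  by rewrite -II; case/andP: (repr_monomialP rho tau).
- move=> /eqP; rewrite -subr_eq0 opprD addNKr oppr_eq0 scaler_eq0.
  by rewrite (negPf dN) orbF gt_eqF.
split=> //; try exact: vertex_transfer ext _.
exact: vertex_transfer vtxw _.
Qed.

(* Turn from an interior direction of tau to a direction along which m' ties   *)
(* with the monomial of tau, and stop at the first tie.                        *)
Lemma edge_of_two_minimal tau v rho m' :
  is_triangle tau -> vertex_of tau v -> (forall i, 0 < v 0 i) ->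
  minimal v rho m' -> m' != repr_monomial rho tau ->
  exists tau tau' w, exceptional_curve tau tau' v w /\ rho \in Gig tau tau'.
Proof.
move=> [u [_ u1] hu] ext v0 hm' mm'.
have [/cellP[[_ v1] /(_ rho) hm] _] := ext.
set m := repr_monomial rho tau in mm' hm.
have cm' : has_character rG m' rho by case: hm'.
have [k [k0 kN km]] : exists k : point,
    [/\ coord_sum k = 0, k != 0 & weight k m = weight k m'].
  apply: (exists_tie_direction v1); last exact: minimal_tie hm hm'.
  by move/eqP; rewrite eq_sym (negPf mm').
pose d1 : point := u - v.
have d1E n : weight d1 n = weight u n - weight v n.
  by rewrite /d1 -scaleN1r weightD weightZ mulN1r.
(* For [b] least at [v], [a b + t * c b] is the excess of its slope along [(1 - t) *: d1 + t *: k]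
   over that of [m]. *)
pose a (b : box) : rat := if `[< minimal v rho (of_box b) >] then
  weight d1 (of_box b) - weight d1 m else 0.
pose c (b : box) : rat := if `[< minimal v rho (of_box b) >] then
  weight k (of_box b) - weight k m - (weight d1 (of_box b) - weight d1 m)
  else 0.
have m'E := minimal_of_box v0 hm'.
have d1m' : weight d1 m < weight d1 m'.
  by rewrite !d1E (minimal_tie hm hm') ltrD2r; exact: hu.
have a0 b : 0 <= a b + 0 * c b.
  rewrite mul0r addr0 /a; case: asboolP => // hb.
  rewrite subr_ge0 !d1E (minimal_tie hm hb) lerD2r.
  have [->//|ne] := eqVneq (of_box b) m.
  by apply/ltW/hu => //; case: hb.
have cm : c (to_box m') < 0.
  by rewrite /c m'E asboolT // -km subrr sub0r oppr_lt0 subr_gt0.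
have [t t0 [ht [b cb tb]]] := exit_time a0 cm.
(* The excess of [m'] is [1 - t] times a positive number, as [m] and [m'] tie along [k]. *)
have t1 : t <= 1.
  have := ht (to_box m'); rewrite /a /c m'E asboolT // -km subrr sub0r.
  have := d1m'; set x := weight _ m; set y := weight _ m'; nra.
have hb : minimal v rho (of_box b).
  by move: cb; rewrite /c; case: asboolP; rewrite ?ltxx.
pose d := (1 - t) *: d1 + t *: k.
have dE n : weight d n = (1 - t) * weight d1 n + t * weight k n.
  by rewrite /d weightD !weightZ.
apply: (@edge_of_tie tau v d rho m (of_box b)) => //.
- rewrite /d coord_sumD !coord_sumZ k0 /d1 -scaleN1r coord_sumD coord_sumZ.
  by rewrite /coord_sum u1 v1; ring.
- have [E|tN] := eqVneq t 1; first by rewrite /d E subrr scale0r add0r scale1r.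
  apply/eqP => dZ; have := dE m; have := dE m'.
  have w0 n : weight (0 : point) n = 0.
    by rewrite -(scale0r (0 : point)) weightZ mul0r.
  rewrite dZ !w0 -km => h1 h2.
  have : (1 - t) * (weight d1 m' - weight d1 m) = 0 by lra.
  move/eqP; rewrite mulf_eq0 !subr_eq0 eq_sym (negPf tN) /=.
  by rewrite gt_eqF.
- apply/eqP => E; move: cb; rewrite /c -E asboolT //; lra.
- move: tb; rewrite /a /c asboolT // !dE.
  set x := weight _ _; set y := weight _ _; set z := weight _ _.
  set q := weight _ _; lra.
- move=> n hn; have nE := minimal_of_box v0 hn.
  have := ht (to_box n); rewrite /a /c nE asboolT // !dE.
  set x := weight _ _; set y := weight _ _; set z := weight _ _.
  set q := weight _ _; lra.
Qed.

(** Otherwise every character has a single least monomial at [v]. These stay least nearby, so a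
    segment centred at [v] lies in one cell, and [v] is not extreme. *)
Lemma vertex_has_edge v : interior_vertex rG v ->
  exists tau tau' w, exists rho,
    exceptional_curve tau tau' v w /\ rho \in Gig tau tau'.
Proof.
move=> [[tau tri ext] v0]; apply: contrapT => none.
have [/cellP[simv hv] mid] := ext; have [_ v1] := simv.
have uniq rho m : minimal v rho m -> m = repr_monomial rho tau.
  move=> hm; apply/eqP; apply: contraT => ne; case: none.
  have [t1 [t2 [w h]]] := edge_of_two_minimal tri ext v0 hm ne.
  by exists t1, t2, w, rho.
pose d : point := turn (delta_mx 0 0).
have d0 : coord_sum d = 0 by exact: coord_sum_turn.
have dN : d != 0.
  apply/eqP => /rowP /(_ 1); rewrite /d turnE !mxE /= => /eqP.
  by rewrite sub0r oppr_eq0.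
have [e e0 pe] := perturb v d.
have inside s : `|s| = e -> cell tau (v + s *: d).
  move=> se; have [|pos sp] := pe s; first by rewrite se.
  have {}pos := pos v0.
  have vge i : 0 <= v 0 i by exact: ltW.
  have uge i : 0 <= (v + s *: d) 0 i by exact: ltW.
  apply/cellP; split; first exact: simplex_shift.
  move=> rho; have [n hn] := minimal_exists uge (repr_monomial_char rho tau).
  by rewrite -(uniq rho n) //; exact: minimal_specializes hn.
have vE : v = 2%:R^-1 *: ((v + e *: d) + (v + (- e) *: d)).
  by apply/rowP => i; rewrite !mxE; field.
have ne : `|e| = e by rewrite gtr0_norm.
have nne : `|- e| = e by rewrite normrN.
have := mid _ _ (inside e ne) (inside (- e) nne) vE.
move=> /addrI /eqP.
rewrite -subr_eq0 -scalerBl scaler_eq0 (negPf dN) orbF opprK.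
by rewrite -mulr2n mulrn_eq0 (gt_eqF e0).
Qed.

End Clusters.

(** * Clusters as stable constellations *)

Section IrreducibleCharacters.

Variables (R : realType) (gT : finGroupType) (G : {group gT}).
Hypothesis abG : abelian G.

Implicit Types (rho : Irr R G).

Let aG := regular_repr R[i] G.

Lemma complex_pcharG : ([pchar R[i]]^'.-group G)%g.
Proof. by rewrite /pgroup pcharf'_nat pnatr_eq0 -lt0n cardG_gt0. Qed.

Lemma complex_splitting : group_splitting_field R[i] G.
Proof. exact: group_closure_closed_field. Qed.

Lemma irr_degree_eq1 rho : irr_degree rho = 1%N.
Proof. exact: (irr_degree_abelian complex_splitting abG). Qed.

Lemma irr_scalar rho g : g \in G ->
  irr_repr rho g = (Defs.irr_char rho g)%:M.
Proof.
move=> Gg; rewrite /Defs.irr_char (irr_center_scalar complex_splitting).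
  by rewrite mxtrace_scalar irr_degree_eq1 mulr1n.
by rewrite (center_idP abG).
Qed.

Lemma irr_char_inj rho rho' :
  {in G, Defs.irr_char rho =1 Defs.irr_char rho'} -> rho = rho'.
Proof.
move=> E; rewrite -(irr_reprK complex_pcharG rho).
rewrite -[RHS](irr_reprK complex_pcharG rho').
apply: (irr_comp_rsim _ complex_pcharG).
have deg : irr_degree rho = irr_degree rho' by rewrite !irr_degree_eq1.
have sc : {in G, forall g, irr_repr rho g = (Defs.irr_char rho g)%:M}.
  exact: irr_scalar.
have sc' : {in G, forall g, irr_repr rho' g = (Defs.irr_char rho g)%:M}.
  by move=> g Gg; rewrite irr_scalar // E.
move: (irr_repr rho) (irr_repr rho') sc sc'; rewrite deg => r r' sc sc'.
exists 1%:M => // [|g Gg]; first by rewrite row_free_unit unitmx1.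
by rewrite sc ?sc' // mulmx1 mul1mx.
Qed.

Lemma irr_of_linear_character (f : gT -> R[i]) :
  f 1%g = 1 -> {in G &, {morph f : x y / (x * y)%g >-> x * y}} ->
  exists rho, {in G, f =1 Defs.irr_char rho}.
Proof.
move=> f1 fM.
have rP : mx_repr G (fun g => (f g)%:M : 'M[R[i]]_1).
  by split=> [|x y Gx Gy]; rewrite ?f1 // fM // scalar_mxM.
pose r := MxRepresentation rP.
have irr : mx_irreducible r by apply/mx_abs_irrW/linear_mx_abs_irr.
have sim := rsim_irr_comp (Irr R G) complex_pcharG irr.
exists (irr_comp (Irr R G) r) => g Gg.
by rewrite /Defs.irr_char -(mxtrace_rsim sim Gg) mxtrace_scalar mulr1n.
Qed.

Lemma rank_irr rho : \rank rho = 1%N.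
Proof.
rewrite (linear_irr_comp complex_pcharG complex_splitting (irr_degree_eq1 rho)).
exact: irr_degree_eq1.
Qed.

(** The isotypic components of the regular representation are lines, since [G] is abelian; any
    nonzero row spans its component. *)
Definition eigenrow rho : 'rV[R[i]]_#|G| := nz_row rho.

Lemma eigenrowE rho : (rho :=: eigenrow rho)%MS.
Proof.
apply/eqmx_sym/eqmxP; rewrite -(geq_leqif (mxrank_leqif_eq (nz_row_sub _))).
by rewrite rank_irr lt0n mxrank_eq0 nz_row_eq0 -mxrank_eq0 rank_irr.
Qed.

Lemma eigenrowJ rho g : g \in G ->
  eigenrow rho *m aG g = Defs.irr_char rho g *: eigenrow rho.
Proof.
move=> Gg; have sub : (eigenrow rho <= socle_base rho)%MS.
  rewrite -(linear_irr_comp complex_pcharG complex_splitting).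
    by rewrite eigenrowE.
  exact: irr_degree_eq1.
rewrite -(in_submodK sub) -(val_submodJ (socle_module rho)) //.
have := irr_scalar rho Gg; rewrite irr_reprE => ->.
by rewrite mul_mx_scalar linearZ.
Qed.

Definition eigenbasis : 'M[R[i]]_(#|{: Irr R G}|, #|G|) :=
  \matrix_k eigenrow (enum_val k).

Lemma card_Irr : #|{: Irr R G}| = #|G|.
Proof.
rewrite -(sum_irr_degree (Irr R G) complex_pcharG complex_splitting).
rewrite -sum1_card; apply: eq_bigr => rho _.
by rewrite irr_degree_eq1.
Qed.

Lemma row_eigenbasis rho : row (enum_rank rho) eigenbasis = eigenrow rho.
Proof. by rewrite rowK enum_rankK. Qed.

Lemma eigenbasis_full : row_full eigenbasis.
Proof.
rewrite -sub1mx -(irr_mx_sum (Irr R G) complex_pcharG).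
apply/sumsmx_subP => rho _; rewrite eigenrowE -row_eigenbasis.
exact: row_sub.
Qed.

Lemma eigenbasis_free : row_free eigenbasis.
Proof. by rewrite /row_free (eqnP eigenbasis_full) card_Irr. Qed.

Lemma eq_on_eigenrows (A B : 'M[R[i]]_#|G|) :
  (forall rho, eigenrow rho *m A = eigenrow rho *m B) -> A = B.
Proof.
move=> AB; have EAB : eigenbasis *m A = eigenbasis *m B.
  by apply/row_matrixP => k; rewrite !row_mul rowK.
rewrite -[A]mul1mx -[B]mul1mx -(mulVpmx eigenbasis_full).
by rewrite -!(mulmxA (pinvmx _)) EAB.
Qed.

Definition matrix_of_images (F : Irr R G -> 'rV[R[i]]_#|G|) : 'M[R[i]]_#|G| :=
  pinvmx eigenbasis *m \matrix_k F (enum_val k).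

Lemma matrix_of_imagesE F rho : eigenrow rho *m matrix_of_images F = F rho.
Proof.
rewrite -row_eigenbasis -row_mul mulmxA (mulmxVp eigenbasis_free) mul1mx.
by rewrite rowK enum_rankK.
Qed.

Lemma sub_sum_irr (B : {set Irr R G}) rho :
  rho \in B -> (rho <= \sum_(s in B) s)%MS.
Proof. by move=> rB; exact: (sumsmx_sup rho). Qed.

Lemma multiplicity_sum_irr (B : {set Irr R G}) rho :
  multiplicity rho (\sum_(s in B) s)%MS = (rho \in B).
Proof.
rewrite /multiplicity irr_degree_eq1 divn1.
have [rB|rB] := boolP (rho \in B).
  have -> : ((\sum_(s in B) s)%MS :&: rho :=: rho)%MS.
    by apply/capmx_idPr/sub_sum_irr.
  exact: rank_irr.
apply/eqP; rewrite mxrank_eq0 -submx0.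
have /mxdirect_sumsP/(_ rho isT) dx := Socle_direct (Irr R G).
rewrite -[X in (_ <= X)%MS]dx capmxC; apply: capmxS => //.
apply/sumsmx_subP => s sB.
by rewrite (sumsmx_sup s) //; apply: contraNneq rB => <-.
Qed.

Lemma theta_rep_sum_irr theta (B : {set Irr R G}) :
  theta_rep theta (\sum_(s in B) s)%MS = \sum_(s in B) theta s.
Proof.
rewrite /theta_rep [RHS]big_mkcond; apply: eq_bigr => s _.
by rewrite multiplicity_sum_irr; case: ifP; rewrite ?mulr1 ?mulr0.
Qed.

Lemma theta_rep_segment (theta theta' : {ffun Irr R G -> rat}) (t : rat)
    (U : 'M[R[i]]_#|G|) :
  theta_rep [ffun rho => (1 - t) * theta rho + t * theta' rho] U =
  theta_rep theta U + t * (theta_rep theta' U - theta_rep theta U).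
Proof.
rewrite /theta_rep -sumrB mulr_sumr -big_split; apply: eq_bigr => s _.
by rewrite /= !ffunE; ring.
Qed.

Lemma multiplicity_le1 rho (U : 'M[R[i]]_#|G|) : (multiplicity rho U <= 1)%N.
Proof.
rewrite /multiplicity irr_degree_eq1 divn1 -(rank_irr rho).
exact: mxrankS (capmxSr _ _).
Qed.

End IrreducibleCharacters.

(** * Persistence of stability in a chamber *)

Section Stability.

Variables (R : realType) (gT : finGroupType) (G : {group gT}).
Variable rG : mx_representation R[i] G 3.
Hypothesis abG : abelian G.

Implicit Types (F : constellation rG) (theta : {ffun Irr R G -> rat}).

(* At the first time when some subsheaf gets theta-value 0, F would be         *)
(* semistable but not stable.                                                  *)
Lemma stable_segment F theta theta' :
  generic_segment rG theta theta' ->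
  Defs.stable theta F -> Defs.stable theta' F.
Proof.
move=> seg st U0 eU0 pU0; rewrite ltNge; apply/negP => bad.
(* Multiplicities are 0 or 1, so subsheaves have finitely many dimension vectors, and [exit_time]
   can run over these. *)
pose dims (U : 'M[R[i]]_#|G|) : {ffun Irr R G -> 'I_2} :=
  [ffun rho => inord (multiplicity rho U)].
pose val (th : {ffun Irr R G -> rat}) (k : {ffun Irr R G -> 'I_2}) : rat :=
  \sum_rho th rho * (k rho)%:R.
have valE th U : theta_rep th U = val th (dims U).
  apply: eq_bigr => rho _; rewrite ffunE inordK //.
  by rewrite ltnS multiplicity_le1.
pose P k := `[< exists U, [/\ equivariant_subsheaf F U, proper_nonzero U
  & dims U = k] >].
pose a k := if P k then val theta k else 0.
pose c k := if P k then val theta' k - val theta k else 0.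
have PU U : equivariant_subsheaf F U -> proper_nonzero U -> P (dims U).
  by move=> eU pU; apply/asboolP; exists U.
have a0 k : 0 <= a k + 0 * c k.
  rewrite mul0r addr0 /a /P; case: asboolP => // -[U [eU pU <-]].
  by rewrite -valE; exact/ltW/st.
have th0 := st _ eU0 pU0.
have c0 : c (dims U0) < 0.
  by rewrite /c PU // -!valE subr_lt0; exact: le_lt_trans th0.
have [t t0 [ht [k ck tk]]] := exit_time a0 c0.
have t1 : t <= 1.
  have := ht (dims U0); rewrite /a /c PU // -!valE.
  move: bad th0; set x := theta_rep _ _; set y := theta_rep _ _; nra.
have [|_ gen] := seg t; first by rewrite t0.
move: ck tk; rewrite /a /c /P; case: asboolP; last by rewrite ltxx.
move=> [U [eU pU <-]] _ tk.
have /gen/(_ U eU pU) : semistable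
    [ffun rho => (1 - t) * theta rho + t * theta' rho] F.
  move=> V eV pV; rewrite theta_rep_segment !valE.
  by have := ht (dims V); rewrite /a /c PU.
by rewrite theta_rep_segment !valE tk ltxx.
Qed.

Lemma stable_chamber F theta theta' :
  same_chamber rG theta theta' -> Defs.stable theta F -> Defs.stable theta' F.
Proof.
move=> [_]; elim=> [x y /stable_segment h|x|x y z _ hx _ hy]; last 2 first.
- by [].
- by move/hx/hy.
exact: h.
Qed.

End Stability.

(** * The constellation of a monomial cluster *)

Section ClusterConstellation.

Variables (R : realType) (gT : finGroupType) (G : {group gT}).
Variable rG : mx_representation R[i] G 3.
Hypothesis abG : abelian G.
Hypothesis rG_diag : {in G, forall g, is_diag_mx (rG g)}.

Variable tau : monomial_cluster rG.

Implicit Types (m n : monomial) (rho : Irr R G).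

Let aG := regular_repr R[i] G.

Lemma mono_char_mul m :
  {in G &, {morph mono_char rG m : x y / (x * y)%g >-> x * y}}.
Proof.
move=> x y Gx Gy; rewrite /mono_char -big_split; apply: eq_bigr => i _ /=.
rewrite -exprMn; congr (_ ^+ _); rewrite repr_mxM // mxE (bigD1 i) //=.
rewrite big1 ?addr0 // => j ji; have /is_diag_mxP -> := rG_diag Gx.
  by rewrite mul0r.
by rewrite eq_sym; exact: ji.
Qed.

Lemma exists_character m : exists rho, has_character rG m rho.
Proof.
have [|rho h] :=
  irr_of_linear_character (f := mono_char rG m) _ (@mono_char_mul m).
  by rewrite /mono_char big1 // => i _; rewrite repr_mx1 mxE eqxx expr1n.
by exists rho; apply/has_characterP.
Qed.

Lemma repr_monomial_inj : injective (fun rho => repr_monomial rho tau).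
Proof.
move=> rho rho' /= E; apply: (irr_char_inj abG) => g Gg.
have /has_characterP <- // := repr_monomial_char rho tau.
by have /has_characterP <- // := repr_monomial_char rho' tau; rewrite E.
Qed.

Definition one_mono : monomial := [ffun => 0%N].
Definition var_mono (i : 'I_3) : monomial := [ffun j => (j == i) : nat].

Lemma mono_char_var i g : mono_char rG (var_mono i) g = rG g i i.
Proof.
rewrite /mono_char (bigD1 i) //= ffunE eqxx expr1 big1 ?mulr1 // => j ji.
by rewrite ffunE (negPf ji) expr0.
Qed.

Lemma has_character1 : has_character rG one_mono [1 Irr R G]%irr.
Proof.
apply/has_characterP => g Gg; rewrite /mono_char big1; last first.
  by move=> i _; rewrite ffunE expr0.
by rewrite /Defs.irr_char irr1_repr ?complex_pcharG // mxtrace1 degree_irr1.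
Qed.

Lemma repr_monomial1 : repr_monomial [1 Irr R G]%irr tau = one_mono.
Proof.
apply/esym/repr_monomial_unique; last exact: has_character1.
have /andP[+ _] := repr_monomialP [1 Irr R G]%irr tau; apply: contra.
by apply: cluster_ideal_closed => i; rewrite ffunE.
Qed.

(* The class of m modulo the ideal, with r_{rho, tau} sent to [eigenrow rho]. *)
Definition mono_vector m : 'rV[R[i]]_#|G| :=
  if [pick rho | repr_monomial rho tau == m] is Some rho then eigenrow rho
  else 0.

Lemma mono_vector_repr rho : mono_vector (repr_monomial rho tau) = eigenrow rho.
Proof.
rewrite /mono_vector; case: pickP => [s /eqP /repr_monomial_inj -> //|].
by move/(_ rho); rewrite eqxx.
Qed.

Lemma mono_vector_ideal m : cluster_ideal tau m -> mono_vector m = 0.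
Proof.
move=> Im; rewrite /mono_vector; case: pickP => // s /eqP E.
by have := repr_monomialP s tau; rewrite E Im.
Qed.

Lemma mono_vectorP m :
  cluster_ideal tau m \/ exists rho, m = repr_monomial rho tau.
Proof.
have [Im|Im] := boolP (cluster_ideal tau m); [by left | right].
have [rho cm] := exists_character m.
by exists rho; exact: repr_monomial_unique.
Qed.

Definition cluster_coord (i : 'I_3) : 'M[R[i]]_#|G| :=
  matrix_of_images
    (fun rho => mono_vector (mono_mul (var_mono i) (repr_monomial rho tau))).

Lemma mono_vectorM i m :
  mono_vector m *m cluster_coord i = mono_vector (mono_mul (var_mono i) m).
Proof.
have [Im|[rho ->]] := mono_vectorP m; last first.
  by rewrite mono_vector_repr matrix_of_imagesE.
rewrite !mono_vector_ideal ?mul0mx //; apply: cluster_ideal_closed Im => j.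
by rewrite ffunE leq_addl.
Qed.

Lemma mono_vectorJ g m : g \in G ->
  mono_vector m *m aG g = mono_char rG m g *: mono_vector m.
Proof.
move=> Gg; have [Im|[rho ->]] := mono_vectorP m.
  by rewrite mono_vector_ideal // mul0mx scaler0.
rewrite mono_vector_repr eigenrowJ //; congr (_ *: _).
by have /has_characterP -> := repr_monomial_char rho tau.
Qed.

Lemma cluster_coordC i j :
  cluster_coord i *m cluster_coord j = cluster_coord j *m cluster_coord i.
Proof.
apply: (eq_on_eigenrows abG) => rho; rewrite -mono_vector_repr.
rewrite (mulmxA _ (cluster_coord i)) (mulmxA _ (cluster_coord j)).
rewrite !mono_vectorM; congr mono_vector.
by apply/ffunP => k; rewrite !ffunE addnCA.
Qed.

Lemma cluster_coord_equivariant i g : g \in G ->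
  cluster_coord i *m aG g = rG g i i *: (aG g *m cluster_coord i).
Proof.
move=> Gg; apply: (eq_on_eigenrows abG) => rho.
rewrite -mono_vector_repr -scalemxAr.
rewrite (mulmxA _ (cluster_coord i)) (mulmxA _ (aG g)) mono_vectorM.
rewrite !mono_vectorJ // -scalemxAl mono_vectorM scalerA mono_charM.
by rewrite mono_char_var.
Qed.

Definition cluster_constellation : constellation rG :=
  Constellation cluster_coordC cluster_coord_equivariant.

(** A coordinate times a basis monomial is either in the ideal, hence zero, or again a basis
    monomial; only the second case constrains [B]. *)
Lemma sum_irr_subsheaf (B : {set Irr R G}) :
  (forall i rho rho', rho \in B ->
     mono_mul (var_mono i) (repr_monomial rho tau) = repr_monomial rho' tau ->
     rho' \in B) ->
  equivariant_subsheaf cluster_constellation (\sum_(s in B) s)%MS.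
Proof.
move=> closedB; apply/andP; split.
  by apply: sumsmx_module => s _; exact: component_mx_module.
apply/forallP => i; rewrite sumsmxMr; apply/sumsmx_subP => rho rB.
rewrite (eqmxMr _ (eigenrowE abG rho)) -mono_vector_repr.
rewrite -[coord_mul _ i]/(cluster_coord i) mono_vectorM.
have [Im|[s E]] := mono_vectorP (mono_mul (var_mono i) (repr_monomial rho tau)).
  by rewrite mono_vector_ideal // sub0mx.
rewrite E mono_vector_repr -(eigenrowE abG).
exact/sub_sum_irr/(closedB i rho).
Qed.

(** The cluster is generated by the class of 1: by induction on the degree, [U] contains the class
    of every monomial. *)
Lemma subsheaf_with_unit U : equivariant_subsheaf cluster_constellation U ->
  (eigenrow [1 Irr R G]%irr <= U)%MS -> row_full U.
Proof.
move=> /andP[_ /forallP stU] U1.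
have mU k : forall m, (\sum_i m i = k)%N -> (mono_vector m <= U)%MS.
  elim: k => [|k IHk] m mk.
    suff -> : m = repr_monomial [1 Irr R G]%irr tau by rewrite mono_vector_repr.
    rewrite repr_monomial1; apply/ffunP => i; rewrite ffunE; apply/eqP.
    by move/eqP: mk; rewrite sum_nat_eq0 => /forallP /(_ i).
  have [/forallP h|] := boolP [forall i, m i == 0%N].
    by move: mk; rewrite big1 // => i _; exact/eqP/h.
  case/forallPn => i; rewrite -lt0n => mi.
  pose n : monomial := [ffun j => (m j - (j == i))%N].
  have mE : m = mono_mul (var_mono i) n.
    apply/ffunP => j; rewrite !ffunE subnKC //.
    by case: eqP => // ->.
  rewrite mE -mono_vectorM; apply: submx_trans (submxMr _ (IHk n _)) (stU i).
  apply/eqP; rewrite -eqSS -mk mE; apply/eqP.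
  under [in RHS]eq_bigr do rewrite ffunE.
  rewrite big_split /= (_ : (\sum_j var_mono i j = 1)%N) //.
  rewrite (bigD1 i) //= big1 ?addn0 ?ffunE ?eqxx // => j ji.
  by rewrite ffunE (negPf ji).
rewrite -sub1mx -(irr_mx_sum (Irr R G) (complex_pcharG R G)).
apply/sumsmx_subP => rho _; rewrite (eigenrowE abG) -mono_vector_repr.
exact: mU.
Qed.

(** A proper subsheaf misses the trivial character by [subsheaf_with_unit], and a nonzero one
    contains some character, being the sum of its isotypic parts; only positive values of [theta]
    contribute. *)
Lemma cluster_stable (theta : {ffun Irr R G -> rat}) :
  (forall rho, rho != [1 Irr R G]%irr -> 0 < theta rho) ->
  Defs.stable theta cluster_constellation.
Proof.
move=> theta0 U eU [nzU nfU]; have /andP[modU _] := eU.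
have mult_rank rho : multiplicity rho U = \rank (U :&: rho)%MS.
  by rewrite /multiplicity irr_degree_eq1 // divn1.
have mult1 : multiplicity [1 Irr R G]%irr U = 0%N.
  apply/eqP; rewrite mult_rank -leqn0 leqNgt; apply: contra nfU => pos.
  apply: subsheaf_with_unit eU _; rewrite -(eigenrowE abG).
  apply/capmx_idPr/eqmxP.
  by rewrite -(geq_leqif (mxrank_leqif_eq (capmxSr _ _))) rank_irr.
have [rho rhoU] : exists rho, (0 < multiplicity rho U)%N.
  apply: contrapT => none; case/negP: nzU; rewrite -submx0.
  have := capmx_subSocle (sG := Irr R G) predT modU.
  rewrite -[X in (U :&: X)%MS]/(Socle (Irr R G)).
  rewrite [Socle _](irr_mx_sum (Irr R G) (complex_pcharG R G)) => cap.
  have /submx_trans -> // : (U <= U :&: 1%:M)%MS.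
    by rewrite sub_capmx submx_refl submx1.
  rewrite cap; apply/sumsmx_subP => s _; rewrite submx0 -mxrank_eq0 -mult_rank.
  by rewrite -leqn0 leqNgt; apply/negP => h; apply: none; exists s.
have rho1 : rho != [1 Irr R G]%irr
  by apply: contraTneq rhoU => ->; rewrite mult1.
rewrite /theta_rep (bigD1 rho) //=; apply: ltr_wpDr; last first.
  by rewrite mulr_gt0 ?theta0 // ltr0n.
apply: sumr_ge0 => s _; have [->|s1] := eqVneq s [1 Irr R G]%irr.
  by rewrite mult1 mulr0.
by rewrite mulr_ge0 // ltW // theta0.
Qed.

Lemma cluster_stable_chamber0 (theta : {ffun Irr R G -> rat}) :
  chamber0 rG theta -> Defs.stable theta cluster_constellation.
Proof.
move=> [theta0 [_ pos same]].
exact: (stable_chamber abG same (cluster_stable pos)).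
Qed.

End ClusterConstellation.

(** * Connected divisors *)

Section Divisor.

Variables (R : realType) (gT : finGroupType) (G : {group gT}).
Variable rG : mx_representation R[i] G 3.
Hypothesis rG_diag : {in G, forall g, is_diag_mx (rG g)}.
Variable D : seq point.
Hypothesis interiorD : exceptional_divisor rG D.
Hypothesis connD : connected_divisor rG D.

Implicit Types (tau : monomial_cluster rG) (rho : Irr R G).

Lemma vertex_minimal tau v rho :
  vertex_of tau v -> minimal rG v rho (repr_monomial rho tau).
Proof. by move=> [/cellP[_ h] _]; exact: h. Qed.

(** A second least monomial at [v] would give, by [edge_of_two_minimal], a curve in D' whose piece
    contains [rho]. *)
Lemma minimal_unique v rho m m' : rho \notin Gig_divisor rG D -> v \in D ->
  minimal rG v rho m -> minimal rG v rho m' -> m = m'.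
Proof.
move=> rN vD hm hm'; have [[tau tri ext] v0] := interiorD vD.
suff E n : minimal rG v rho n -> n = repr_monomial rho tau.
  by rewrite (E m) // (E m').
move=> hn; apply/eqP; apply: contraNT rN => ne.
have [t [t' [w [h gig]]]] := edge_of_two_minimal rG_diag tri ext v0 hn ne.
by rewrite inE; apply/asboolP; exists t, t', v, w; rewrite vD.
Qed.

(** An edge in D' has an endpoint in [D] where the monomials of both its triangles are least, and
    one of them is not that of [tau0]. Conversely, for [rho] outside Gig(D') least monomials are
    unique on [D]; adjacent vertices share a triangle, so the monomial of [tau0] propagates from
    [v0] along the connected divisor. *)
Lemma Gig_divisorP tau0 v0 rho : v0 \in D -> vertex_of tau0 v0 ->
  reflect (exists v m, [/\ v \in D, minimal rG v rho m
             & m <> repr_monomial rho tau0])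
    (rho \in Gig_divisor rG D).
Proof.
move=> v0D ext0; apply: (iffP idP).
  rewrite inE => /asboolP[t [t' [v [w [[_ _ _ _ [tv tw t'v t'w]] vw]]]]].
  rewrite inE => /eqP ne.
  have [x [xD tx t'x]] : exists x, [/\ x \in D, vertex_of t x & vertex_of t' x].
    by case/orP: vw => ?; [exists v | exists w].
  have [E|/eqP ne'] := eqVneq (repr_monomial rho t) (repr_monomial rho tau0).
    exists x, (repr_monomial rho t'); split=> //; first exact: vertex_minimal.
    by rewrite -E => E'; apply: ne.
  by exists x, (repr_monomial rho t); split=> //; exact: vertex_minimal.
move=> [v [m [vD hm ne]]]; apply/negPn/negP => rN; apply: ne.
suff : minimal rG v rho (repr_monomial rho tau0) by exact: minimal_unique.
have [_ conn] := connD.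
elim: {v vD hm} (conn _ _ v0D vD) (vertex_minimal rho ext0) => //.
  move=> x y [xD yD [t [_ [_ _ _ _ [tx ty _ _]]]]] hx.
  rewrite (minimal_unique rN xD hx (vertex_minimal rho tx)).
  exact: vertex_minimal.
by move=> x y z _ h1 _ h2 /h1 /h2.
Qed.

(** Let [m] rival the monomial of [rho] at [v]. If [rho'] were outside Gig(D'), its monomial x_i
    r_{rho, tau0} would be the only least one at [v]; but x_i m has the same character and is no
    heavier, so cancelling x_i gives m = r_{rho, tau0}. *)
Lemma Gig_divisor_closed tau0 v0 i rho rho' :
  v0 \in D -> vertex_of tau0 v0 -> rho \in Gig_divisor rG D ->
  mono_mul (var_mono i) (repr_monomial rho tau0) = repr_monomial rho' tau0 ->
  rho' \in Gig_divisor rG D.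
Proof.
move=> v0D ext0 /(Gig_divisorP _ v0D ext0)[v [m [vD hm ne]]] E.
apply: contraT => rN.
have [cm hmin] := hm; have cr := repr_monomial_char rho tau0.
have cr' := repr_monomial_char rho' tau0.
have cxm : has_character rG (mono_mul (var_mono i) m) rho'.
  by apply: has_characterMl cr cm _; rewrite E.
have hr' : minimal rG v rho' (repr_monomial rho' tau0).
  have [_ v_pos] := interiorD vD.
  have [|n hn] := minimal_exists rG_diag (u := v) _ cr'.
    by move=> j; exact: ltW.
  have [//|/eqP ne'] := eqVneq n (repr_monomial rho' tau0); [by move=> <-|].
  by case/negP: rN; apply/(Gig_divisorP _ v0D ext0); exists v, n.
have hxm : minimal rG v rho' (mono_mul (var_mono i) m).
  by apply: minimal_eq hr' cxm _; rewrite -E !weightM lerD2l; exact: hmin.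
case: ne; have := minimal_unique rN vD hxm hr'.
rewrite -E => /ffunP eqM; apply/ffunP => j.
by have := eqM j; rewrite !ffunE => /addnI.
Qed.

(** At an interior vertex the monomial 1 has weight 0 and every other monomial has positive
    weight. *)
Lemma principal_notin_Gig_divisor : [1 Irr R G]%irr \notin Gig_divisor rG D.
Proof.
have [nD _] := connD; case E: D nD => [//|v0 D'] _; rewrite -E.
have v0D : v0 \in D by rewrite E mem_head.
have [[tau0 _ ext0] _] := interiorD v0D.
apply/(Gig_divisorP _ v0D ext0) => -[v [m [vD [_ hm] ne]]]; apply: ne.
rewrite repr_monomial1; apply/ffunP => i; rewrite ffunE.
have [_ v_pos] := interiorD vD.
have := hm _ (has_character1 rG); rewrite [X in _ <= X]big1; last first.
  by move=> j _; rewrite ffunE mulr0.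
move=> le0; apply/eqP; rewrite -leqn0 -(ler_nat rat).
rewrite -(ler_pM2l (v_pos i)) mulr0; apply: le_trans le0.
rewrite /weight (bigD1 i) //= lerDl; apply: sumr_ge0 => j _.
by rewrite mulr_ge0 ?ler0n // ltW.
Qed.

End Divisor.

Theorem proposition2p6 (R : realType) (gT : finGroupType) (G : {group gT})
    (rG : mx_representation R[i] G 3) (hG : abelian G)
    (hdiag : diagonal_SL3 rG)
    (D : seq point) (hD : exceptional_divisor rG D)
    (hconn : connected_divisor rG D)
    (theta : {ffun Irr R G -> rat}) (htheta : chamber0 rG theta) :
  0 < \sum_(chi in Gig_divisor rG D) theta chi.
Proof.
have [_ rG_diag _] := hdiag.
have [nD _] := hconn; case E: D nD => [//|v0 D'] _; rewrite -E.
have v0D : v0 \in D by rewrite E mem_head.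
have int0 := hD _ v0D; have [[tau0 _ ext0] _] := int0.
rewrite -theta_rep_sum_irr //.
have st := @cluster_stable_chamber0 _ _ _ _ hG rG_diag tau0 _ htheta.
apply: st.
  apply: sum_irr_subsheaf => // i rho rho'.
  exact: (Gig_divisor_closed rG_diag hD hconn v0D ext0).
split.
  have [t [t' [w [rho [curve gig]]]]] := vertex_has_edge rG_diag int0.
  have rB : rho \in Gig_divisor rG D.
    by rewrite inE; apply/asboolP; exists t, t', v0, w; rewrite v0D.
  apply: contra_eqN (rank_irr hG rho) => /eqP U0.
  by have := sub_sum_irr rB; rewrite U0 submx0 => /eqP ->; rewrite mxrank0.
(* A full submodule would contain the trivial character, which is not in Gig(D'). *)
apply/negP => full.
have := multiplicity_sum_irr hG (Gig_divisor rG D) [1 Irr R G]%irr.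
rewrite (negPf (principal_notin_Gig_divisor rG_diag hD hconn)).
rewrite /multiplicity irr_degree_eq1 // divn1 => rank0.
have cap : ((\sum_(s in Gig_divisor rG D) s)%MS :&: [1 Irr R G]%irr
    :=: [1 Irr R G]%irr)%MS by apply/capmx_idPr/submx_full.
by have := rank_irr hG [1 Irr R G]%irr; rewrite -cap rank0.
Qed.
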